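(* Let $$\vec V=(\rho,v^1,v^2,v^3,s,\Omega^1,\Omega^2,\Omega^3,S^1,S^2,S^3)$$ denote the array of unknowns in the system (1)-(9) given in the context (a reformulation of the compressible Euler equations), and let $g$ be the acoustical metric. Then the inhomogeneous terms on the right-hand sides of equations (1)-(9) consist of three types: (i) terms of the form $f(\vec V)$, where $f$ is smooth and vanishes when $S=\Omega\equiv0$; (ii) terms of the form $f(\vec V)\cdot\partial\vec V$, where $f$ is smooth, that is, terms that depend linearly on $\partial\vec V$; (iii) terms of the form $f(\vec V)\,\mathfrak{Q}(\partial\vec V,\partial\vec V)$, where $f$ is smooth and $\mathfrak{Q}$ is a standard null form relative to $g$.
   Context: Coordinates and indices: $(x^0,x^1,x^2,x^3)$ are Cartesian coordinates on $\mathbb{R}^{1+3}$, $x^0=t$, $\partial_\alpha=\partial/\partial x^\alpha$. Greek indices range over $0,1,2,3$, Latin indices over $1,2,3$, repeated indices are summed. $\delta$ is the Kronecker delta; $\epsilon_{ijk}$ is fully antisymmetric with $\epsilon_{123}=1$; $\mathrm{div}\,V=\partial_aV^a$, $(\mathrm{curl}\,V)^i=\epsilon_{iab}\partial_aV^b$; $Vf=V^\alpha\partial_\alpha f$. Fluid variables: $v$ is the velocity, $\varrho>0$ the density, $s$ the entropy, $\bar\varrho>0$ a fixed constant, $\rho=\ln(\varrho/\bar\varrho)$, $p$ the pressure, a given smooth function (the equation of state) viewed as a function of $(\rho,s)$. Subscripts $;\rho$ and $;s$ denote partial derivatives of functions of $(\rho,s)$. The speed of sound $c=c(\rho,s)=\sqrt{\bar\varrho^{-1}\exp(-\rho)p_{;\rho}}$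 is assumed positive for all $\rho\in(-\infty,\infty)$. $B=\partial_t+v^a\partial_a$ is the material derivative, $\Omega=\exp(-\rho)\,\mathrm{curl}\,v$ the specific vorticity, $S^i=\partial_is$ the entropy gradient, and $$\mathcal{C}^i=\exp(-\rho)(\mathrm{curl}\,\Omega)^i+\exp(-3\rho)c^{-2}\frac{p_{;s}}{\bar\varrho}S^a\partial_av^i-\exp(-3\rho)c^{-2}\frac{p_{;s}}{\bar\varrho}(\partial_av^a)S^i,$$ $$\mathcal{D}=\exp(-2\rho)\,\mathrm{div}\,S-\exp(-2\rho)S^a\partial_a\rho.$$ On the right-hand sides below, $\mathcal{C}^i$ and $\mathcal{D}$ are understood through these definitions. The acoustical metric is $g=-dt\otimes dt+c^{-2}\sum_{a}(dx^a-v^adt)\otimes(dx^a-v^adt)$ with inverse $g^{-1}=-B\otimes B+c^2\sum_a\partial_a\otimes\partial_a$, and $\square_g\phi=|\det g|^{-1/2}\partial_\alpha\{|\det g|^{1/2}(g^{-1})^{\alpha\beta}\partial_\beta\phi\}$; in equation (1) the Cartesian components $v^i$ are treated as scalar functions. Standard null forms relative to $g$: they act on pairs of scalar functions $\phi,\widetilde\phi$ by $$\mathfrak{Q}^g(\partial\phi,\partial\widetilde\phi)=(g^{-1})^{\alpha\beta}\partial_\alpha\phi\,\partial_\beta\widetilde\phi,\qquad \mathfrak{Q}_{(\alpha\beta)}(\partial\phi,\partial\widetilde\phi)=\partial_\alpha\phi\,\partial_\beta\widetilde\phi-\partial_\alpha\widetilde\phi\,\partial_\beta\phi;$$ in type (iii)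 they are applied to pairs of entries of $\vec V$. The system ($i=1,2,3$): (1) $\square_gv^i=-c^2\exp(2\rho)\mathcal{C}^i+\mathfrak{Q}_{(v)}^i+\mathfrak{L}_{(v)}^i$; (2) $\square_g\rho=-\exp(\rho)\frac{p_{;s}}{\bar\varrho}\mathcal{D}+\mathfrak{Q}_{(\rho)}+\mathfrak{L}_{(\rho)}$; (3) $B\Omega^i=\mathfrak{L}_{(\Omega)}^i$; (4) $Bs=0$; (5) $BS^i=\mathfrak{L}_{(S)}^i$; (6) $\mathrm{div}\,\Omega=\mathfrak{L}_{(\mathrm{div}\,\Omega)}$; (7) $B\mathcal{C}^i=-2\delta_{jk}\epsilon_{iab}\exp(-\rho)(\partial_av^j)\partial_b\Omega^k+\epsilon_{ajk}\exp(-\rho)(\partial_av^i)\partial_j\Omega^k+\exp(-3\rho)c^{-2}\frac{p_{;s}}{\bar\varrho}\{(BS^a)\partial_av^i-(Bv^i)\partial_aS^a\}+\exp(-3\rho)c^{-2}\frac{p_{;s}}{\bar\varrho}\{(Bv^a)\partial_aS^i-(\partial_av^a)BS^i\}+\mathfrak{Q}_{(\mathcal{C})}^i+\mathfrak{L}_{(\mathcal{C})}^i$; (8) $B\mathcal{D}=2\exp(-2\rho)\{(\partial_av^a)\partial_bS^b-(\partial_av^b)\partial_bS^a\}+\exp(-\rho)\delta_{ab}(\mathrm{curl}\,\Omega)^aS^b+\mathfrak{Q}_{(\mathcal{D})}$; (9) $(\mathrm{curl}\,S)^i=0$. Here $$\mathfrak{Q}_{(v)}^i=-\{1+c^{-1}c_{;\rho}\}(g^{-1})^{\alpha\beta}\partial_\alpha\rho\,\partial_\beta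 v^i,$$ $$\mathfrak{Q}_{(\rho)}=-3c^{-1}c_{;\rho}(g^{-1})^{\alpha\beta}\partial_\alpha\rho\,\partial_\beta\rho+\{(\partial_av^a)(\partial_bv^b)-(\partial_av^b)\partial_bv^a\},$$ $$\begin{aligned}\mathfrak{Q}_{(\mathcal{C})}^i={}&\exp(-3\rho)c^{-2}\frac{p_{;s}}{\bar\varrho}S^i\{(\partial_av^b)\partial_bv^a-(\partial_av^a)\partial_bv^b\}+\exp(-3\rho)c^{-2}\frac{p_{;s}}{\bar\varrho}\{(\partial_av^a)S^b\partial_bv^i-(S^a\partial_av^b)\partial_bv^i\}\\&+2\exp(-3\rho)c^{-2}\frac{p_{;s}}{\bar\varrho}\{(S^a\partial_a\rho)Bv^i-(B\rho)S^a\partial_av^i\}+2\exp(-3\rho)c^{-3}c_{;\rho}\frac{p_{;s}}{\bar\varrho}\{(S^a\partial_a\rho)Bv^i-(B\rho)S^a\partial_av^i\}\\&+\exp(-3\rho)c^{-2}\frac{p_{;s;\rho}}{\bar\varrho}\{(B\rho)S^a\partial_av^i-(S^a\partial_a\rho)Bv^i\}+\exp(-3\rho)c^{-2}\frac{p_{;s;\rho}}{\bar\varrho}S^i\{(Bv^a)\partial_a\rho-(\partial_av^a)B\rho\}\\&+2\exp(-3\rho)c^{-2}\frac{p_{;s}}{\bar\varrho}S^i\{(\partial_av^a)B\rho-(Bv^a)\partial_a\rho\}+2\exp(-3\rho)c^{-3}c_{;\rho}\frac{p_{;s}}{\bar\varrho}S^i\{(\partial_av^a)B\rho-(Bv^a)\partial_a\rho\},\end{aligned}$$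 $$\mathfrak{Q}_{(\mathcal{D})}=2\exp(-2\rho)\{(S^a\partial_av^b)\partial_b\rho-(\partial_av^a)S^b\partial_b\rho\},$$ $$\begin{aligned}\mathfrak{L}_{(v)}^i={}&2\exp(\rho)\epsilon_{iab}(Bv^a)\Omega^b-\frac{p_{;s}}{\bar\varrho}\epsilon_{iab}\Omega^aS^b-\exp(-\rho)\frac{p_{;s}}{\bar\varrho}S^a\partial_av^i-\tfrac12\exp(-\rho)\frac{p_{;\rho;s}}{\bar\varrho}S^a\partial_av^i\\&-2\exp(-\rho)c^{-1}c_{;\rho}\frac{p_{;s}}{\bar\varrho}(B\rho)S^i+\exp(-\rho)\frac{p_{;s;\rho}}{\bar\varrho}(B\rho)S^i,\end{aligned}$$ $$\mathfrak{L}_{(\rho)}=-2\exp(-\rho)\frac{p_{;s;\rho}}{\bar\varrho}S^a\partial_a\rho-\exp(-\rho)\frac{p_{;s;s}}{\bar\varrho}\delta_{ab}S^aS^b,$$ $$\mathfrak{L}_{(\Omega)}^i=\Omega^a\partial_av^i-\exp(-2\rho)c^{-2}\frac{p_{;s}}{\bar\varrho}\epsilon_{iab}(Bv^a)S^b,\quad \mathfrak{L}_{(S)}^i=-S^a\partial_av^i+\epsilon_{iab}\exp(\rho)\Omega^aS^b,\quad \mathfrak{L}_{(\mathrm{div}\,\Omega)}=-\Omega^a\partial_a\rho,$$ $$\begin{aligned}\mathfrak{L}_{(\mathcal{C})}^i={}&2\exp(-3\rho)c^{-3}c_{;s}\frac{p_{;s}}{\bar\varrho}(Bv^i)\delta_{ab}S^aS^b-2\exp(-3\rho)c^{-3}c_{;s}\frac{p_{;s}}{\bar\varrho}\delta_{ab}S^a(Bv^b)S^i\\&+\exp(-3\rho)c^{-2}\frac{p_{;s;s}}{\bar\varrho}(Bv^i)\delta_{ab}S^aS^b-\exp(-3\rho)c^{-2}\frac{p_{;s;s}}{\bar\varrho}\delta_{ab}(Bv^a)S^bS^i.\end{aligned}$$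 *)

(* Defs.v *)
From HB Require Import structures.
From mathcomp Require Import all_boot all_order all_algebra.
From mathcomp Require Import all_classical all_reals all_analysis.

Set Implicit Arguments.
Unset Strict Implicit.
Unset Printing Implicit Defensive.

Import Order.TTheory GRing.Theory Num.Theory.
Import numFieldNormedType.Exports.

Local Open Scope ring_scope.

Section Smoothness.
Context {R : realType} {n : nat}.

Definition partial (i : 'I_n.+1) (f : 'rV[R]_n.+1 -> R) : 'rV[R]_n.+1 -> R :=
  fun x => 'D_(delta_mx 0 i) f x.

(* C^oo: every iterated partial derivative (including f itself) is Frechet
   differentiable at every point. *)
Definition smooth (f : 'rV[R]_n.+1 -> R) : Prop :=
  forall (l : seq 'I_n.+1) (x : 'rV[R]_n.+1),
    differentiable (foldr partial f l) x.

End Smoothness.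

Section Unknowns.
Context {R : realType}.

(* Points of R^{1+3}; coordinate 0 is t and the Latin index a : 'I_3
   is the Greek index [lift ord0 a]. *)
Definition spacetime := 'rV[R]_4.
Definition field := spacetime -> R.

(* Values of the array (rho, v^1..v^3, s, Omega^1..Omega^3, S^1..S^3). *)
Definition state := 'rV[R]_11.
Definition unknowns := spacetime -> state.

Definition idx_rho : 'I_11 := inord 0.
Definition idx_v (i : 'I_3) : 'I_11 := inord (1 + i).
Definition idx_s : 'I_11 := inord 4.
Definition idx_Omega (i : 'I_3) : 'I_11 := inord (5 + i).
Definition idx_S (i : 'I_3) : 'I_11 := inord (8 + i).

Definition space (a : 'I_3) : 'I_4 := lift ord0 a.

(* 'I_3 carries addition modulo 3: the first summand detects the cyclic
   permutations and the second one the anticyclic ones. *)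
Definition eps (i j k : 'I_3) : R :=
  ((j == i + 1) && (k == i + 2))%:R - ((j == i + 2) && (k == i + 1))%:R.

Definition kron (j k : 'I_3) : R := (j == k)%:R.

Definition div (X : 'I_3 -> field) : field :=
  fun x => \sum_a partial (space a) (X a) x.

Definition curl (X : 'I_3 -> field) (i : 'I_3) : field :=
  fun x => \sum_a \sum_b eps i a b * partial (space a) (X b) x.

End Unknowns.

Arguments spacetime R : clear implicits.
Arguments field R : clear implicits.
Arguments state R : clear implicits.
Arguments unknowns R : clear implicits.

Section Thermodynamics.
Context {R : realType}.
Variables (rho_bar : R) (p : 'rV[R]_2 -> R).

(* Functions of (rho, s) are functions on 'rV_2. *)
Definition d_rho (h : 'rV[R]_2 -> R) : 'rV[R]_2 -> R := partial (inord 0) h.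
Definition d_s (h : 'rV[R]_2 -> R) : 'rV[R]_2 -> R := partial (inord 1) h.

Definition sound_speed (z : 'rV[R]_2) : R :=
  Num.sqrt (rho_bar^-1 * expR (- z 0 (inord 0)) * d_rho p z).

Definition thermo (W : state R) : 'rV[R]_2 :=
  \row_(j < 2) (if j == inord 0 then W 0 idx_rho else W 0 idx_s).

End Thermodynamics.

Section AcousticGeometry.
Context {R : realType}.
Variables (rho_bar : R) (p : 'rV[R]_2 -> R).

(* Components of B = d_t + v^a d_a. *)
Definition material (W : state R) : 'rV[R]_4 :=
  \row_alpha (if unlift ord0 alpha is Some a then W 0 (idx_v a) else 1).

(* Components of the one-form dx^a - v^a dt. *)
Definition coframe (W : state R) (a : 'I_3) : 'rV[R]_4 :=
  \row_alpha (if unlift ord0 alpha is Some b then kron a b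
              else - W 0 (idx_v a)).

Definition metric (W : state R) : 'M[R]_4 :=
  \matrix_(alpha, beta)
    (- ((alpha == ord0) && (beta == ord0))%:R
     + (sound_speed rho_bar p (thermo W)) ^- 2
       * (\sum_a coframe W a 0 alpha * coframe W a 0 beta)).

Definition inv_metric (W : state R) : 'M[R]_4 :=
  \matrix_(alpha, beta)
    (- (material W 0 alpha * material W 0 beta)
     + (sound_speed rho_bar p (thermo W)) ^+ 2
       * (\sum_a (alpha == space a)%:R * (beta == space a)%:R)).

Definition Bderiv (V : unknowns R) (phi : field R) : field R :=
  fun x => \sum_alpha material (V x) 0 alpha * partial alpha phi x.

Definition box (V : unknowns R) (phi : field R) : field R :=
  let vol y := Num.sqrt `|\det (metric (V y))| in
  fun x => (vol x)^-1 * (\sum_alpha partial alpha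
    (fun y => vol y *
       (\sum_beta inv_metric (V y) alpha beta * partial beta phi y)) x).

Definition null_g (V : unknowns R) (phi psi : field R) : field R :=
  fun x => \sum_alpha \sum_beta
    inv_metric (V x) alpha beta * partial alpha phi x * partial beta psi x.

Definition null_ab (alpha beta : 'I_4) (phi psi : field R) : field R :=
  fun x => partial alpha phi x * partial beta psi x
           - partial alpha psi x * partial beta phi x.

End AcousticGeometry.

Section System.
Context {R : realType}.
Variables (rho_bar : R) (p : 'rV[R]_2 -> R).
Variable V : unknowns R.

Let rho : field R := fun x => V x 0 idx_rho.
Let v (i : 'I_3) : field R := fun x => V x 0 (idx_v i).
Let s : field R := fun x => V x 0 idx_s.
Let Omega (i : 'I_3) : field R := fun x => V x 0 (idx_Omega i).
Let S (i : 'I_3) : field R := fun x => V x 0 (idx_S i).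

Let c : field R := fun x => sound_speed rho_bar p (thermo (V x)).
Let c_rho : field R := fun x => d_rho (sound_speed rho_bar p) (thermo (V x)).
Let c_s : field R := fun x => d_s (sound_speed rho_bar p) (thermo (V x)).
Let p_s : field R := fun x => d_s p (thermo (V x)).
Let p_rho_s : field R := fun x => d_s (d_rho p) (thermo (V x)).
Let p_s_rho : field R := fun x => d_rho (d_s p) (thermo (V x)).
Let p_s_s : field R := fun x => d_s (d_s p) (thermo (V x)).

Let d (a : 'I_3) (phi : field R) : field R := partial (space a) phi.
Let B (phi : field R) : field R := Bderiv V phi.
Let Sd (phi : field R) : field R := fun x => \sum_a S a x * d a phi x.
Let e (k : R) : field R := fun x => expR (k * rho x).

Definition mod_C (i : 'I_3) : field R := fun x =>
  e (- 1) x * curl Omega i x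
  + e (- 3) x * c x ^- 2 * (p_s x / rho_bar) * Sd (v i) x
  - e (- 3) x * c x ^- 2 * (p_s x / rho_bar) * div v x * S i x.

Definition mod_D : field R := fun x =>
  e (- 2) x * div S x - e (- 2) x * Sd rho x.

Definition Q_v (i : 'I_3) : field R := fun x =>
  - (1 + (c x)^-1 * c_rho x)
  * (\sum_alpha \sum_beta inv_metric rho_bar p (V x) alpha beta
       * partial alpha rho x * partial beta (v i) x).

Definition Q_rho : field R := fun x =>
  - 3 * (c x)^-1 * c_rho x
    * (\sum_alpha \sum_beta inv_metric rho_bar p (V x) alpha beta
         * partial alpha rho x * partial beta rho x)
  + (\sum_a \sum_b (d a (v a) x * d b (v b) x - d a (v b) x * d b (v a) x)).

Definition Q_C (i : 'I_3) : field R := fun x =>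
  e (- 3) x * c x ^- 2 * (p_s x / rho_bar) * S i x
    * (\sum_a \sum_b (d a (v b) x * d b (v a) x - d a (v a) x * d b (v b) x))
  + e (- 3) x * c x ^- 2 * (p_s x / rho_bar)
    * (\sum_a \sum_b (d a (v a) x * S b x * d b (v i) x
                      - S a x * d a (v b) x * d b (v i) x))
  + 2 * e (- 3) x * c x ^- 2 * (p_s x / rho_bar)
    * (Sd rho x * B (v i) x - B rho x * Sd (v i) x)
  + 2 * e (- 3) x * c x ^- 3 * c_rho x * (p_s x / rho_bar)
    * (Sd rho x * B (v i) x - B rho x * Sd (v i) x)
  + e (- 3) x * c x ^- 2 * (p_s_rho x / rho_bar)
    * (B rho x * Sd (v i) x - Sd rho x * B (v i) x)
  + e (- 3) x * c x ^- 2 * (p_s_rho x / rho_bar) * S i x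
    * (\sum_a (B (v a) x * d a rho x - d a (v a) x * B rho x))
  + 2 * e (- 3) x * c x ^- 2 * (p_s x / rho_bar) * S i x
    * (\sum_a (d a (v a) x * B rho x - B (v a) x * d a rho x))
  + 2 * e (- 3) x * c x ^- 3 * c_rho x * (p_s x / rho_bar) * S i x
    * (\sum_a (d a (v a) x * B rho x - B (v a) x * d a rho x)).

Definition Q_D : field R := fun x =>
  2 * e (- 2) x
  * (\sum_a \sum_b (S a x * d a (v b) x * d b rho x
                    - d a (v a) x * S b x * d b rho x)).

Definition L_v (i : 'I_3) : field R := fun x =>
  2 * e 1 x * (\sum_a \sum_b eps i a b * B (v a) x * Omega b x)
  - (p_s x / rho_bar) * (\sum_a \sum_b eps i a b * Omega a x * S b x)
  - e (- 1) x * (p_s x / rho_bar) * Sd (v i) x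
  - 2^-1 * e (- 1) x * (p_rho_s x / rho_bar) * Sd (v i) x
  - 2 * e (- 1) x * (c x)^-1 * c_rho x * (p_s x / rho_bar) * B rho x * S i x
  + e (- 1) x * (p_s_rho x / rho_bar) * B rho x * S i x.

Definition L_rho : field R := fun x =>
  - 2 * e (- 1) x * (p_s_rho x / rho_bar) * Sd rho x
  - e (- 1) x * (p_s_s x / rho_bar)
    * (\sum_a \sum_b kron a b * S a x * S b x).

Definition L_Omega (i : 'I_3) : field R := fun x =>
  (\sum_a Omega a x * d a (v i) x)
  - e (- 2) x * c x ^- 2 * (p_s x / rho_bar)
    * (\sum_a \sum_b eps i a b * B (v a) x * S b x).

Definition L_S (i : 'I_3) : field R := fun x =>
  - Sd (v i) x + (\sum_a \sum_b eps i a b * e 1 x * Omega a x * S b x).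

Definition L_div_Omega : field R := fun x =>
  - (\sum_a Omega a x * d a rho x).

Definition L_C (i : 'I_3) : field R := fun x =>
  2 * e (- 3) x * c x ^- 3 * c_s x * (p_s x / rho_bar) * B (v i) x
    * (\sum_a \sum_b kron a b * S a x * S b x)
  - 2 * e (- 3) x * c x ^- 3 * c_s x * (p_s x / rho_bar)
    * (\sum_a \sum_b kron a b * S a x * B (v b) x) * S i x
  + e (- 3) x * c x ^- 2 * (p_s_s x / rho_bar) * B (v i) x
    * (\sum_a \sum_b kron a b * S a x * S b x)
  - e (- 3) x * c x ^- 2 * (p_s_s x / rho_bar)
    * (\sum_a \sum_b kron a b * B (v a) x * S b x) * S i x.

Record equation := Equation { lhs : field R; rhs : field R }.

Definition eq1 (i : 'I_3) : equation := Equation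
  (box rho_bar p V (v i))
  (fun x => - (c x ^+ 2) * e 2 x * mod_C i x + Q_v i x + L_v i x).

Definition eq2 : equation := Equation
  (box rho_bar p V rho)
  (fun x => - e 1 x * (p_s x / rho_bar) * mod_D x + Q_rho x + L_rho x).

Definition eq3 (i : 'I_3) : equation := Equation (B (Omega i)) (L_Omega i).

Definition eq4 : equation := Equation (B s) (fun=> 0).

Definition eq5 (i : 'I_3) : equation := Equation (B (S i)) (L_S i).

Definition eq6 : equation := Equation (div Omega) L_div_Omega.

Definition eq7 (i : 'I_3) : equation := Equation
  (B (mod_C i))
  (fun x =>
    - 2 * (\sum_j \sum_k \sum_a \sum_b kron j k * eps i a b * e (- 1) x
             * d a (v j) x * d b (Omega k) x)
    + (\sum_a \sum_j \sum_k eps a j k * e (- 1) x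
         * d a (v i) x * d j (Omega k) x)
    + e (- 3) x * c x ^- 2 * (p_s x / rho_bar)
      * (\sum_a (B (S a) x * d a (v i) x - B (v i) x * d a (S a) x))
    + e (- 3) x * c x ^- 2 * (p_s x / rho_bar)
      * (\sum_a (B (v a) x * d a (S i) x - d a (v a) x * B (S i) x))
    + Q_C i x + L_C i x).

Definition eq8 : equation := Equation
  (B mod_D)
  (fun x =>
    2 * e (- 2) x
      * (\sum_a \sum_b (d a (v a) x * d b (S b) x - d a (v b) x * d b (S a) x))
    + e (- 1) x * (\sum_a \sum_b kron a b * curl Omega a x * S b x)
    + Q_D x).

Definition eq9 (i : 'I_3) : equation := Equation (curl S i) (fun=> 0).

Inductive label :=
  | E1 of 'I_3 | E2 | E3 of 'I_3 | E4 | E5 of 'I_3 | E6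
  | E7 of 'I_3 | E8 | E9 of 'I_3.

Definition euler_system (l : label) : equation :=
  match l with
  | E1 i => eq1 i
  | E2 => eq2
  | E3 i => eq3 i
  | E4 => eq4
  | E5 i => eq5 i
  | E6 => eq6
  | E7 i => eq7 i
  | E8 => eq8
  | E9 i => eq9 i
  end.

End System.

Section Terms.
Context {R : realType}.
Variables (rho_bar : R) (p : 'rV[R]_2 -> R).

(* A term is an expression in the unknowns, so that the coefficient f of each
   type below does not depend on the particular fields substituted in it. *)
Definition term := unknowns R -> field R.

Definition component (V : unknowns R) (k : 'I_11) : field R := fun x => V x 0 k.

Definition type_i (T : term) : Prop :=
  exists f : state R -> R,
    [/\ smooth f,
        (forall W : state R,
           (forall i, W 0 (idx_S i) = 0) -> (forall i, W 0 (idx_Omega i) = 0) ->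
           f W = 0)
      & forall V x, T V x = f (V x)].

Definition type_ii (T : term) : Prop :=
  exists f : state R -> R, exists (alpha : 'I_4) (k : 'I_11),
    smooth f /\
    forall V x, T V x = f (V x) * partial alpha (component V k) x.

Definition standard_null_form
    (Q : unknowns R -> field R -> field R -> field R) : Prop :=
  Q = null_g rho_bar p \/ exists alpha beta, Q = fun=> null_ab alpha beta.

Definition type_iii (T : term) : Prop :=
  exists f : state R -> R, exists Q, exists k l : 'I_11,
    [/\ smooth f, standard_null_form Q &
        forall V x, T V x = f (V x) * Q V (component V k) (component V l) x].

End Terms.

(* Main.v *)
Require Import Defs.
From mathcomp Require Import all_boot all_order all_algebra.
From mathcomp Require Import all_classical all_reals all_analysis.
From mathcomp Require Import ring.
Import Order.TTheory GRing.Theory Num.Theory.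
Import numFieldNormedType.Exports.
Local Open Scope ring_scope.

(** Every right-hand side is a finite sum of products of smooth functions of
    the unknowns with first derivatives of the unknowns, at most two of the
    latter in each product.  Products without a derivative always carry a
    component of S, products with one derivative are linear, so the content of
    the theorem lies in the quadratic products.

    The quadratic products that are not visibly of the form
    g^{-1}(d phi, d psi) always come in differences
      (X phi)(Y psi) - (X psi)(Y phi),
    where X and Y are first-order operators with coefficients smooth in the
    unknowns: coordinate derivatives, B = d_t + v^a d_a, or S^a d_a.  By
    bilinearity such a difference is the sum over alpha, beta of
    X^alpha Y^beta Q_(alpha beta)(d phi, d psi), a combination of antisymmetric
    null forms with smooth coefficients ([decomposable_wedge]).  This covers:
    - the difference of squares (div v)^2 - (d_a v^b)(d_b v^a) and its
      analogues, possibly after interchanging the two summation indices in one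
      half of the sum;
    - the terms contracted with the Levi-Civita symbol, which are components of
      grad phi x grad psi ([decomposable_cross_gradient]);
    - the pairs in which B and a spatial derivative exchange their arguments.
    All of these rewritings are pointwise polynomial identities in the first
    derivatives of the unknowns.

    Besides this algebra, the coefficients have to be smooth functions of the
    state, although smoothness is phrased through all iterated partial
    derivatives.  [smoothP] replaces it by membership in the classes
    [diff_class k] for all k, and closure under sums, products, exp,
    inverses, square roots and linear substitutions then follows by induction
    on k, the differentiation rules expressing the partials of the new function
    through functions already known to be in the previous class.  The speed of
    sound is smooth because its positivity forces the radicand to be
    positive. *)

Set Implicit Arguments.
Unset Strict Implicit.
Unset Printing Implicit Defensive.

(** * Smooth functions of finitely many real variables *)

Lemma derive_affine {R : numFieldType} {U W : normedModType R} (f : U -> W)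
    (x v : U) (w : W) :
  (forall t : R, f (t *: v + x) - f x = t *: w) -> 'D_v f x = w.
Proof.
move=> fE; rewrite /derive; apply: cvg_lim => //.
apply: cvg_near_cst; near=> t.
rewrite /= fE scalerA mulVf ?scale1r //.
by near: t; exact: nbhs_dnbhs_neq.
Unshelve. all: by end_near. Qed.

Section DifferentiabilityClasses.
Context {R : realType} {n : nat}.
Implicit Types (f g : 'rV[R]_n.+1 -> R) (i : 'I_n.+1) (x : 'rV[R]_n.+1).

(** Differentiability to order k, by recursion on the derivative that is taken
    first.  The differentiation rules rewrite precisely that derivative, as a
    combination of functions to which an induction hypothesis on k applies;
    [smooth] has it at the far end of a list of arbitrary length. *)
Fixpoint diff_class k f : Prop :=
  (forall x, differentiable f x) /\
  (if k is k'.+1 then forall i, diff_class k' (partial i f) else True).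

Lemma diff_class_partial k f i :
  diff_class k.+1 f -> diff_class k (partial i f).
Proof. by case=> _ pf; exact: pf. Qed.

Lemma diff_classW k f : diff_class k.+1 f -> diff_class k f.
Proof.
elim: k f => [|k IHk] f [df pf]; split=> // i.
exact: IHk (pf i).
Qed.

Lemma diff_class_differentiable k f x : diff_class k f -> differentiable f x.
Proof. by case: k => [|k] [df _]; exact: df. Qed.

Lemma smoothP f : smooth f <-> forall k, diff_class k f.
Proof.
split=> [sf k | df l].
  elim: k f sf => [|k IHk] f sf.
    by split=> // x; exact: (sf [::]).
  split=> [x|i]; first exact: (sf [::]).
  by apply: IHk => l x; rewrite -foldr_rcons; exact: sf.
elim/last_ind: l f df => [|l i IHl] f df x.
  exact: (diff_class_differentiable x (df 0)).
by rewrite foldr_rcons; apply: IHl => k; have [_] := df k.+1; exact.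
Qed.

Lemma smooth_partial i f : smooth f -> smooth (partial i f).
Proof. by move=> sf l x; rewrite -foldr_rcons; exact: sf. Qed.

Lemma partial_chain (phi : R -> R) f (dphi : R) i x :
  differentiable f x -> is_derive (f x) 1 phi dphi ->
  partial i (fun y => phi (f y)) x = dphi * partial i f x.
Proof.
move=> df [dphif phiE].
have dphix : differentiable phi (f x) by exact/derivable1_diffP.
rewrite /partial deriveE; last exact: differentiable_comp.
rewrite (@diff_comp _ _ _ _ f phi) //= diff1E // deriveE // derive1E phiE.
by rewrite mulrC.
Qed.

Lemma differentiable_chain (phi : R -> R) f (dphi : R) x :
  differentiable f x -> is_derive (f x) 1 phi dphi ->
  differentiable (fun y => phi (f y)) x.
Proof.
by move=> df [dphif _]; apply: differentiable_comp => //; exact/derivable1_diffP.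
Qed.

Lemma diff_class_cst k (a : R) : diff_class k (fun=> a).
Proof.
elim: k a => [|k IHk] a; split=> // i.
rewrite (_ : partial i _ = fun=> 0) //.
by apply/funext => x; exact: derive_cst.
Qed.

Lemma diff_classD k f g :
  diff_class k f -> diff_class k g -> diff_class k (fun x => f x + g x).
Proof.
elim: k f g => [|k IHk] f g [df pf] [dg pg].
  by split=> // x; exact: differentiableD.
split=> [x|i]; first exact: differentiableD.
rewrite (_ : partial i _ = fun x => partial i f x + partial i g x).
  exact: IHk (pf i) (pg i).
by apply/funext => x; apply: deriveD; exact: diff_derivable.
Qed.

Lemma diff_classM k f g :
  diff_class k f -> diff_class k g -> diff_class k (fun x => f x * g x).
Proof.
elim: k f g => [|k IHk] f g cf cg; have [df pf] := cf; have [dg pg] := cg.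
  by split=> // x; exact: differentiableM.
split=> [x|i]; first exact: differentiableM.
rewrite (_ : partial i _ = fun x => f x * partial i g x + g x * partial i f x).
  by apply: diff_classD; apply: IHk;
    by [exact: diff_classW|exact: diff_class_partial].
by apply/funext => x; apply: deriveM; exact: diff_derivable.
Qed.

Lemma diff_class_sum k (I : Type) (r : seq I) (F : I -> 'rV[R]_n.+1 -> R) :
  (forall j, diff_class k (F j)) -> diff_class k (fun x => \sum_(j <- r) F j x).
Proof.
move=> cF; elim: r => [|j r IHr].
  rewrite (_ : (fun x => _) = fun=> 0); first exact: diff_class_cst.
  by apply/funext => x; rewrite big_nil.
rewrite (_ : (fun x => _) = fun x => F j x + \sum_(j <- r) F j x).
  exact: diff_classD.
by apply/funext => x; rewrite big_cons.
Qed.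

Lemma diff_class_exp k f : diff_class k f -> diff_class k (fun x => expR (f x)).
Proof.
elim: k f => [|k IHk] f cf; have [df pf] := cf.
  by split=> // x; exact: (differentiable_chain (df x) (is_derive_expR _)).
split=> [x|i]; first exact: (differentiable_chain (df x) (is_derive_expR _)).
rewrite (_ : partial i _ = fun x => expR (f x) * partial i f x).
  apply: diff_classM; last exact: pf.
  by apply: IHk; exact: diff_classW.
by apply/funext => x; exact: (partial_chain i (df x) (is_derive_expR _)).
Qed.

(** The partials of 1/f involve 1/f itself, which the induction hypothesis puts
    in the class of one order less; exp and the square root behave alike. *)
Lemma diff_classV k f :
  (forall x, f x != 0) -> diff_class k f -> diff_class k (fun x => (f x)^-1).
Proof.
move=> f0; elim: k f f0 => [|k IHk] f f0 cf; have [df pf] := cf.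
  by split=> // x; exact: differentiableV.
split=> [x|i]; first exact: differentiableV.
rewrite (_ : partial i _ =
    fun x => - 1 * ((f x)^-1 * (f x)^-1 * partial i f x)).
  apply: diff_classM; first exact: diff_class_cst.
  apply: diff_classM; last exact: pf.
  by apply: diff_classM; apply: IHk => //; exact: diff_classW.
apply/funext => x; rewrite /partial deriveV //; last exact: diff_derivable.
by rewrite mulN1r scaleNr -invfM expr2.
Qed.

Lemma diff_class_sqrt k f :
  (forall x, 0 < f x) -> diff_class k f ->
  diff_class k (fun x => Num.sqrt (f x)).
Proof.
move=> f0; elim: k f f0 => [|k IHk] f f0 cf; have [df pf] := cf.
  by split=> // x; exact: (differentiable_chain (df x) (is_derive1_sqrt (f0 x))).
split=> [x|i].
  exact: (differentiable_chain (df x) (is_derive1_sqrt (f0 x))).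
rewrite (_ : partial i _ = fun x => (2 * Num.sqrt (f x))^-1 * partial i f x).
  apply: diff_classM; last exact: pf.
  apply: diff_classV => [x|].
    by rewrite mulf_neq0 // ?pnatr_eq0 // gt_eqF // sqrtr_gt0.
  apply: diff_classM; first exact: diff_class_cst.
  by apply: IHk => //; exact: diff_classW.
apply/funext => x.
exact: (partial_chain i (df x) (is_derive1_sqrt (f0 x))).
Qed.

Lemma diff_class_coord k (j : 'I_n.+1) :
  diff_class k (fun x : 'rV[R]_n.+1 => x 0 j).
Proof.
have D x : differentiable (fun x : 'rV[R]_n.+1 => x 0 j) x.
  exact: differentiable_coord.
case: k => [|k]; split=> // i.
rewrite (_ : partial i _ = fun=> (i == j)%:R); first exact: diff_class_cst.
apply/funext => x; apply: derive_affine => t.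
by rewrite !mxE eqxx /= eq_sym addrK.
Qed.

End DifferentiabilityClasses.

(** The partial derivatives of h (x A) are linear combinations of those of h,
    again composed with x |-> x A, so the induction must range over all h. *)
Lemma diff_class_mulmx {R : realType} {m n : nat} (A : 'M[R]_(m.+1, n.+1)) k
    (h : 'rV[R]_n.+1 -> R) :
  diff_class k h -> diff_class k (fun x : 'rV[R]_m.+1 => h (x *m A)).
Proof.
have dA x : differentiable (fun x : 'rV[R]_m.+1 => x *m A) x.
  have -> : (fun x : 'rV[R]_m.+1 => x *m A) =
      \sum_(i < m.+1) (fun x : 'rV[R]_m.+1 => x 0 i *: row i A).
    by apply/funext => y; rewrite mulmx_sum_row fct_sumE.
  apply: differentiable_sum => i.
  by apply: differentiableZl; exact: differentiable_coord.
elim: k h => [|k IHk] h [dh ph].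
  by split=> // x; exact: (@differentiable_comp _ _ _ _ (fun x => x *m A) h).
split=> [x|i].
  exact: (@differentiable_comp _ _ _ _ (fun x => x *m A) h).
rewrite (_ : partial i _ =
    fun x => \sum_j A i j * partial j h (x *m A)).
  apply: diff_class_sum => j; apply: diff_classM; first exact: diff_class_cst.
  exact: IHk (ph j).
apply/funext => x; rewrite /partial deriveE; last first.
  exact: (@differentiable_comp _ _ _ _ (fun x => x *m A) h).
rewrite (@diff_comp _ _ _ _ (fun x => x *m A) h) //=.
rewrite -[X in 'd h _ X]deriveE //.
have -> : 'D_(delta_mx 0 i) (fun x : 'rV[R]_m.+1 => x *m A) x = row i A.
  by apply: derive_affine => t; rewrite mulmxDl addrK -scalemxAl -rowE.
rewrite [row i A]row_sum_delta linear_sum; apply: eq_bigr => j _.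
by rewrite linearZ /= mxE deriveE.
Qed.

(** * Coefficients: smooth functions of the unknowns *)

Section Coefficients.
Context {R : realType}.
Implicit Types (A : @term R) (f : state R -> R).

Definition coefficient A : Prop :=
  exists2 f : state R -> R, smooth f & forall V x, A V x = f (V x).

Lemma coefficient_cst (a : R) : coefficient (fun _ _ => a).
Proof.
by exists (fun=> a) => //; apply/smoothP => k; exact: diff_class_cst.
Qed.

Lemma coefficient_component (j : 'I_11) : coefficient (fun V x => V x 0 j).
Proof.
by exists (fun W => W 0 j) => //; apply/smoothP => k; exact: diff_class_coord.
Qed.

Lemma coefficientD A1 A2 : coefficient A1 -> coefficient A2 ->
  coefficient (fun V x => A1 V x + A2 V x).
Proof.
move=> [f1 /smoothP s1 E1] [f2 /smoothP s2 E2].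
exists (fun W => f1 W + f2 W) => [|V x]; last by rewrite E1 E2.
by apply/smoothP => k; exact: diff_classD.
Qed.

Lemma coefficientM A1 A2 : coefficient A1 -> coefficient A2 ->
  coefficient (fun V x => A1 V x * A2 V x).
Proof.
move=> [f1 /smoothP s1 E1] [f2 /smoothP s2 E2].
exists (fun W => f1 W * f2 W) => [|V x]; last by rewrite E1 E2.
by apply/smoothP => k; exact: diff_classM.
Qed.

Lemma coefficientN A : coefficient A -> coefficient (fun V x => - A V x).
Proof.
move=> cA; have [f sf fE] := coefficientM (coefficient_cst (-1)) cA.
by exists f => // V x; rewrite -fE mulN1r.
Qed.

Lemma coefficientX A n :
  coefficient A -> coefficient (fun V x => A V x ^+ n).
Proof.
move=> cA; elim: n => [|n [f sf fE]]; first exact: coefficient_cst.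
have [g sg gE] := coefficientM cA (ex_intro2 _ _ f sf fE).
by exists g => // V x; rewrite exprS -gE.
Qed.

Lemma coefficient_exp A : coefficient A -> coefficient (fun V x => expR (A V x)).
Proof.
move=> [f /smoothP sf fE]; exists (fun W => expR (f W)) => [|V x].
  by apply/smoothP => k; exact: diff_class_exp.
by rewrite fE.
Qed.

Lemma coefficient_sum (I : finType) (A : I -> @term R) :
  (forall j, coefficient (A j)) -> coefficient (fun V x => \sum_j A j V x).
Proof.
move=> cA; elim: (index_enum I) => [|j r IHr].
  have [f sf fE] := coefficient_cst 0.
  by exists f => // V x; rewrite big_nil -(fE V x).
have [f sf fE] := coefficientD (cA j) IHr.
by exists f => // V x; rewrite big_cons -fE.
Qed.

Lemma coefficient_thermo (h : 'rV[R]_2 -> R) :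
  smooth h -> coefficient (fun V x => h (thermo (V x))).
Proof.
move=> /smoothP sh; exists (fun W => h (thermo W)) => //.
(* thermo selects two coordinates, which is a linear map. *)
pose A : 'M[R]_(11, 2) :=
  \matrix_(i, j) (i == if j == inord 0 then idx_rho else idx_s)%:R.
have thermoE W : thermo W = W *m A.
  apply/rowP => j; rewrite !mxE.
  rewrite (bigD1 (if j == inord 0 then idx_rho else idx_s)) //= mxE eqxx mulr1.
  rewrite big1 => [|i /negPf ij]; last by rewrite mxE ij mulr0.
  by rewrite addr0; case: ifP.
have -> : (fun W => h (thermo W)) = (fun W => h (W *m A)).
  by apply/funext => W; rewrite thermoE.
by apply/smoothP => k; exact: diff_class_mulmx.
Qed.

Lemma coefficient_material (alpha : 'I_4) :
  coefficient (fun V x => material (V x) 0 alpha).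
Proof.
rewrite /material; case: (unliftP ord0 alpha) => [a|] ->.
  have [f sf fE] := coefficient_component (idx_v a).
  by exists f => // V x; rewrite mxE liftK.
have [f sf fE] := coefficient_cst 1.
by exists f => // V x; rewrite mxE unlift_none.
Qed.

End Coefficients.

(** * Finite sums of terms of the three types *)

Section Decomposition.
Context {R : realType}.
Variables (rho_bar : R) (p : 'rV[R]_2 -> R).
Implicit Types (T A : @term R).

Definition admissible T : Prop :=
  type_i T \/ type_ii T \/ type_iii rho_bar p T.

Definition decomposable T : Prop :=
  exists (n : nat) (U : 'I_n -> @term R),
    (forall j, admissible (U j)) /\ forall V x, T V x = \sum_(j < n) U j V x.

Lemma eq_decomposable T1 T2 :
  (forall V x, T1 V x = T2 V x) -> decomposable T2 -> decomposable T1.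
Proof. by move=> E [n [U [aU UE]]]; exists n, U; split=> // V x; rewrite E. Qed.

Lemma admissible_decomposable T : admissible T -> decomposable T.
Proof. by move=> aT; exists 1, (fun=> T); split=> // V x; rewrite big_ord1. Qed.

Lemma decomposable0 : decomposable (fun _ _ => 0).
Proof.
exists 0, (fun _ _ _ => 0); split=> [[]//|V x].
by rewrite big_ord0.
Qed.

Lemma decomposableD T1 T2 : decomposable T1 -> decomposable T2 ->
  decomposable (fun V x => T1 V x + T2 V x).
Proof.
move=> [n1 [U1 [a1 E1]]] [n2 [U2 [a2 E2]]].
exists (n1 + n2)%N, (fun j =>
  match fintype.split j with inl i => U1 i | inr i => U2 i end).
split=> [j|V x]; first by case: (fintype.split j).
rewrite E1 E2 big_split_ord /=.
by congr (_ + _); apply: eq_bigr => j _;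
  rewrite ?(unsplitK (inl j)) ?(unsplitK (inr j)).
Qed.

Lemma decomposable_sum (I : finType) (T : I -> @term R) :
  (forall i, decomposable (T i)) -> decomposable (fun V x => \sum_i T i V x).
Proof.
move=> dT; elim: (index_enum I) => [|i r IHr].
  by apply: eq_decomposable decomposable0 => V x; rewrite big_nil.
by apply: eq_decomposable (decomposableD (dT i) IHr) => V x; rewrite big_cons.
Qed.

(** Each type is stable under multiplication by a smooth function of the
    unknowns; hence only S, the first derivatives and the null forms need be
    decomposed, all other factors being absorbed in f. *)
Lemma admissibleMl A T :
  coefficient A -> admissible T -> admissible (fun V x => A V x * T V x).
Proof.
move=> [f sf AE].
have sM g : smooth g -> smooth (fun W => f W * g W).
  move=> /smoothP sg; apply/smoothP => k; apply: diff_classM => //.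
  by move: k; apply/smoothP.
case=> [[g [sg g0 TE]]|[[g [alpha [k [sg TE]]]]|[g [Q [k [l [sg nQ TE]]]]]]].
- left; exists (fun W => f W * g W); split=> [|W S0 O0|V x]; first exact: sM.
    by rewrite g0 ?mulr0.
  by rewrite AE TE.
- right; left; exists (fun W => f W * g W), alpha, k; split; first exact: sM.
  by move=> V x; rewrite AE TE mulrA.
- right; right; exists (fun W => f W * g W), Q, k, l; split=> // [|V x].
    exact: sM.
  by rewrite AE TE mulrA.
Qed.

Lemma decomposableMl A T :
  coefficient A -> decomposable T -> decomposable (fun V x => A V x * T V x).
Proof.
move=> cA [n [U [aU UE]]]; exists n, (fun j V x => A V x * U j V x).
split=> [j|V x]; first exact: admissibleMl.
by rewrite UE mulr_sumr.
Qed.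

Lemma decomposableMr A T :
  coefficient A -> decomposable T -> decomposable (fun V x => T V x * A V x).
Proof.
move=> cA dT; apply: eq_decomposable (decomposableMl cA dT) => V x.
exact: mulrC.
Qed.

Lemma decomposableN T : decomposable T -> decomposable (fun V x => - T V x).
Proof.
move=> dT; apply: eq_decomposable (decomposableMl (coefficient_cst (-1)) dT).
by move=> V x; rewrite mulN1r.
Qed.

Lemma decomposable_S a : decomposable (fun V x => V x 0 (idx_S a)).
Proof.
apply: admissible_decomposable; left; exists (fun W => W 0 (idx_S a)).
split=> [|W S0 _|//]; last exact: S0.
by apply/smoothP => k; exact: diff_class_coord.
Qed.

Let smooth1 : smooth (fun _ : state R => 1).
Proof. by apply/smoothP => k; exact: diff_class_cst. Qed.

Lemma decomposable_partial alpha k :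
  decomposable (fun V x => partial alpha (fun y => V y 0 k) x).
Proof.
apply: admissible_decomposable; right; left; exists (fun=> 1), alpha, k.
by split=> // V x; rewrite mul1r.
Qed.

Lemma decomposable_null_g k l : decomposable (fun V =>
  null_g rho_bar p V (fun y => V y 0 k) (fun y => V y 0 l)).
Proof.
apply: admissible_decomposable; right; right.
exists (fun=> 1), (null_g rho_bar p), k, l.
by split=> // [|V x]; [left|rewrite mul1r].
Qed.

Lemma decomposable_null_ab alpha beta k l : decomposable (fun V =>
  null_ab alpha beta (fun y => V y 0 k) (fun y => V y 0 l)).
Proof.
apply: admissible_decomposable; right; right.
exists (fun=> 1), (fun=> null_ab alpha beta), k, l.
by split=> // [|V x]; [right; exists alpha, beta|rewrite mul1r].
Qed.

(** * Null forms from pairs of vector fields *)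

(** First-order operators X = X^alpha d_alpha whose components are smooth
    functions of the unknowns. *)
Definition vector_field (X : unknowns R -> field R -> field R) : Prop :=
  exists2 a : 'I_4 -> @term R, (forall alpha, coefficient (a alpha)) &
    forall V phi x, X V phi x = \sum_alpha a alpha V x * partial alpha phi x.

(** The value on the bivector X /\ Y of the two-form d V^k /\ d V^l. *)
Definition wedge_form (X Y : unknowns R -> field R -> field R) (k l : 'I_11)
    : @term R := fun V x =>
  X V (fun y => V y 0 k) x * Y V (fun y => V y 0 l) x
  - X V (fun y => V y 0 l) x * Y V (fun y => V y 0 k) x.

Lemma decomposable_vector_field X k : vector_field X ->
  decomposable (fun V => X V (fun y => V y 0 k)).
Proof.
move=> [a ca XE]; apply: eq_decomposable => [V x|]; first exact: XE.
apply: decomposable_sum => alpha; apply: decomposableMl => //.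
exact: decomposable_partial.
Qed.

(** The two-form dV^k /\ dV^l has the standard antisymmetric null forms as its
    components, and X^alpha Y^beta are admissible coefficients. *)
Lemma decomposable_wedge X Y k l : vector_field X -> vector_field Y ->
  decomposable (wedge_form X Y k l).
Proof.
move=> [a ca XE] [b cb YE].
apply: (@eq_decomposable _ (fun V x => \sum_alpha \sum_beta
  a alpha V x * b beta V x
  * null_ab alpha beta (fun y => V y 0 k) (fun y => V y 0 l) x)).
  move=> V x; rewrite /wedge_form !XE !YE !big_distrlr /= -sumrB.
  apply: eq_bigr => alpha _; rewrite -sumrB; apply: eq_bigr => beta _.
  by rewrite /null_ab; ring.
apply: decomposable_sum => alpha; apply: decomposable_sum => beta.
apply: decomposableMl; first exact: coefficientM.
exact: decomposable_null_ab.
Qed.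

Lemma vector_field_partial alpha : vector_field (fun=> partial alpha).
Proof.
exists (fun beta _ _ => (beta == alpha)%:R) => [beta|V phi x].
  exact: coefficient_cst.
rewrite (bigD1 alpha) //= eqxx mul1r big1 ?addr0 // => beta /negPf ->.
by rewrite mul0r.
Qed.

Lemma vector_field_B : vector_field Bderiv.
Proof.
by exists (fun alpha V x => material (V x) 0 alpha) => // alpha;
  exact: coefficient_material.
Qed.

Definition space_deriv (a : 'I_3) : unknowns R -> field R -> field R :=
  fun=> partial (Defs.space a).

Definition S_deriv (V : unknowns R) (phi : field R) : field R :=
  fun x => \sum_a V x 0 (idx_S a) * partial (Defs.space a) phi x.

Lemma vector_field_S : vector_field S_deriv.
Proof.
exists (fun alpha V x =>
  \sum_a V x 0 (idx_S a) * (alpha == Defs.space a)%:R) => [alpha|V phi x].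
  apply: coefficient_sum => a; apply: coefficientM; last exact: coefficient_cst.
  exact: coefficient_component.
under [RHS]eq_bigr do rewrite mulr_suml.
rewrite exchange_big; apply: eq_bigr => a _.
rewrite (bigD1 (Defs.space a)) //= eqxx mulr1 big1 ?addr0 // => beta /negPf ->.
by rewrite mulr0 mul0r.
Qed.

Lemma eps_antisym (i a b : 'I_3) : eps i a b = - eps i b a :> R.
Proof. by rewrite /eps opprB ![(b == _) && _]andbC. Qed.

Lemma eps_cyclic (i a b : 'I_3) : eps i a b = eps b i a :> R.
Proof.
by case: i a b => [[|[|[|//]]] ?] [[|[|[|//]]] ?] [[|[|[|//]]] ?].
Qed.

(** Contraction with the Levi-Civita symbol antisymmetrizes the product, at the
    price of a factor one half. *)
Lemma decomposable_cross_gradient i k l : decomposable (fun V x =>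
  \sum_a \sum_b eps i a b * (partial (Defs.space a) (fun y => V y 0 k) x
                           * partial (Defs.space b) (fun y => V y 0 l) x)).
Proof.
apply: (@eq_decomposable _ (fun V x => 2^-1 * \sum_a \sum_b eps i a b *
    wedge_form (space_deriv a) (space_deriv b) k l V x)) => [V x|].
  under [in RHS]eq_bigr do under eq_bigr do rewrite mulrBr.
  under [in RHS]eq_bigr do rewrite sumrB.
  rewrite sumrB [X in _ - X]exchange_big /=.
  under [X in _ - X]eq_bigr do under eq_bigr do
    rewrite eps_antisym mulNr [X in eps _ _ _ * X]mulrC.
  under [X in _ - X]eq_bigr do rewrite sumrN.
  by rewrite sumrN opprK -mulr2n -[X in _ * X]mulr_natl mulKf // pnatr_eq0.
apply: decomposableMl; first exact: coefficient_cst.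
apply: decomposable_sum => a; apply: decomposable_sum => b.
apply: decomposableMl; first exact: coefficient_cst.
by apply: decomposable_wedge; exact: vector_field_partial.
Qed.

End Decomposition.

(** * The right-hand sides of the system *)

Section RightHandSides.
Context {R : realType}.
Variables (rho_bar : R) (p : 'rV[R]_2 -> R).
Hypotheses (p_smooth : smooth p)
  (c_gt0 : forall z : 'rV[R]_2, 0 < sound_speed rho_bar p z).

(** A positive square root has a positive radicand, where the square root is
    smooth. *)
Lemma smooth_sound_speed : smooth (sound_speed rho_bar p).
Proof.
apply/smoothP => k; apply: diff_class_sqrt => [z|].
  by rewrite -sqrtr_gt0; exact: c_gt0.
apply: diff_classM; last by move: k; apply/smoothP/smooth_partial.
apply: diff_classM; first exact: diff_class_cst.
apply: diff_class_exp.
rewrite (_ : (fun _ => _) = fun z : 'rV[R]_2 => -1 * z 0 (inord 0)).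
  by apply: diff_classM; [exact: diff_class_cst|exact: diff_class_coord].
by apply/funext => z; rewrite mulN1r.
Qed.

Lemma coefficient_c_inv :
  coefficient (fun V x => (sound_speed rho_bar p (thermo (V x)))^-1).
Proof.
apply: (coefficient_thermo (h := fun z => (sound_speed rho_bar p z)^-1)).
apply/smoothP => k; apply: diff_classV => [z|]; first by rewrite gt_eqF.
by move: k; apply/smoothP/smooth_sound_speed.
Qed.

Lemma coefficient_c_expN n :
  coefficient (fun V x => sound_speed rho_bar p (thermo (V x)) ^- n).
Proof.
have [f sf fE] := coefficientX n coefficient_c_inv.
by exists f => // V x; rewrite -fE exprVn.
Qed.

(** [coef] and [dec] are driven by the syntax of the expression, since a failing
    unification would unfold the operators into large sums before giving up. *)
Ltac coef := lazymatch goal with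
  | |- coefficient (fun _ _ => ?a) => exact: coefficient_cst
  | |- coefficient (fun V x => fun_of_matrix (V x) _ ?k) =>
      exact: coefficient_component
  | |- coefficient (fun V x => sound_speed _ _ (thermo (V x)) ^- ?n) =>
      exact: coefficient_c_expN
  | |- coefficient (fun V x => (sound_speed _ _ (thermo (V x)))^-1) =>
      exact: coefficient_c_inv
  | |- coefficient (fun V x => _ (thermo (V x))) =>
      apply: coefficient_thermo; repeat apply: smooth_partial;
      first [exact: smooth_sound_speed|exact: p_smooth]
  | |- coefficient (fun V x => expR _) => apply: coefficient_exp; coef
  | |- coefficient (fun V x => _ * _) => apply: coefficientM; coef
  | |- coefficient (fun V x => _ + _) => apply: coefficientD; coef
  | |- coefficient (fun V x => - _) => apply: coefficientN; coef
  | |- coefficient (fun V x => _ ^+ _) => apply: coefficientX; coef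
  | |- coefficient (fun V x => \sum_(i <- _) _) =>
      apply: coefficient_sum => ?; coef
  end.

(** In a product exactly one factor is left over once the coefficients are
    removed: a component of S, a derivative, or a difference of products of
    derivatives.  Where several factors have order zero, as in Omega^a S^b, the
    last one is kept, so that products without derivatives end on S. *)
Ltac dec := lazymatch goal with
  | |- decomposable _ _ (fun _ _ => 0) => exact: decomposable0
  | |- decomposable _ _ (fun V x => partial _ _ x) => exact: decomposable_partial
  | |- decomposable _ _ (fun V x => Bderiv V _ x) =>
      exact: (decomposable_vector_field _ _ _ vector_field_B)
  | |- decomposable _ _ (fun V x => fun_of_matrix (V x) _ (idx_S _)) =>
      exact: decomposable_S
  | |- decomposable _ _ (fun V x => _ + _) => apply: decomposableD; dec
  | |- decomposable _ _ (fun V x => - _) => apply: decomposableN; dec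
  | |- decomposable _ _ (fun V x => \sum_(i <- _) _) =>
      apply: decomposable_sum => ?; dec
  | |- decomposable _ _ (fun V x => _ * _) =>
      first [ apply: decomposableMl; [solve [coef]|dec]
            | apply: decomposableMr; [solve [coef]|dec]]
  | _ => apply: decomposable_wedge;
      first [exact: vector_field_partial|exact: vector_field_B
            |exact: vector_field_S]
  end.

Local Notation dcp := (decomposable rho_bar p).
Local Notation D := (@space_deriv R).
Local Notation B := (@Bderiv R).
Local Notation Sd := (@S_deriv R).

(** Some quadratic expressions become antisymmetric in their derivatives only
    after the two summation indices are interchanged in the subtracted half. *)
Lemma sum_transpose (F G : 'I_3 -> 'I_3 -> R) :
  \sum_a \sum_b (F a b - G a b) = \sum_a \sum_b (F a b - G b a).
Proof.
under eq_bigr do rewrite sumrB; under [RHS]eq_bigr do rewrite sumrB.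
by rewrite !sumrB [X in _ - X = _]exchange_big.
Qed.

Lemma decomposable_mod_C i : dcp (fun V x => mod_C rho_bar p V i x).
Proof. by cbv zeta beta delta [mod_C curl Defs.div]; dec. Qed.

Lemma decomposable_mod_D : dcp (fun V x => mod_D V x).
Proof. by cbv zeta beta delta [mod_D Defs.div]; dec. Qed.

Lemma decomposable_L_v i : dcp (fun V x => L_v rho_bar p V i x).
Proof. by cbv zeta beta delta [L_v]; dec. Qed.

Lemma decomposable_L_rho : dcp (fun V x => L_rho rho_bar p V x).
Proof. by cbv zeta beta delta [L_rho]; dec. Qed.

Lemma decomposable_L_Omega i : dcp (fun V x => L_Omega rho_bar p V i x).
Proof. by cbv zeta beta delta [L_Omega]; dec. Qed.

Lemma decomposable_L_S i : dcp (fun V x => L_S V i x).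
Proof. by cbv zeta beta delta [L_S]; dec. Qed.

Lemma decomposable_L_div_Omega : dcp (fun V x => L_div_Omega V x).
Proof. by cbv zeta beta delta [L_div_Omega]; dec. Qed.

Lemma decomposable_L_C i : dcp (fun V x => L_C rho_bar p V i x).
Proof. by cbv zeta beta delta [L_C]; dec. Qed.

Lemma decomposable_Q_v i : dcp (fun V x => Q_v rho_bar p V i x).
Proof.
cbv zeta beta delta [Q_v]; apply: decomposableMl; first by coef.
exact: decomposable_null_g.
Qed.

Lemma decomposable_Q_rho : dcp (fun V x => Q_rho rho_bar p V x).
Proof.
cbv zeta beta delta [Q_rho]; apply: decomposableD.
  apply: decomposableMl; first by coef.
  exact: decomposable_null_g.
apply: decomposable_sum => a; apply: decomposable_sum => b.
exact: (decomposable_wedge _ _ (idx_v a) (idx_v b) (vector_field_partial _)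
          (vector_field_partial _)).
Qed.

Lemma decomposable_Q_D : dcp (fun V x => Q_D V x).
Proof.
cbv zeta beta delta [Q_D]; apply: decomposableMl; first by coef.
apply: (@eq_decomposable _ _ _ _ (fun V x => \sum_a \sum_b V x 0 (idx_S a) *
  wedge_form (D a) (D b) (idx_v b) idx_rho V x)).
  move=> V x; rewrite sum_transpose.
  apply: eq_bigr => a _; apply: eq_bigr => b _.
  by rewrite /wedge_form /space_deriv; ring.
by dec.
Qed.

(** Each of the eight terms is a multiple of its own antisymmetric pairing, so
    no cancellation between different terms is involved. *)
Lemma decomposable_Q_C i : dcp (fun V x => Q_C rho_bar p V i x).
Proof.
cbv zeta beta delta [Q_C].
apply: (@eq_decomposable _ _ _ _ (fun V x =>
  let e := expR (- 3 * V x 0 idx_rho) in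
  let c := sound_speed rho_bar p (thermo (V x)) in
  let c_rho := d_rho (sound_speed rho_bar p) (thermo (V x)) in
  let p_s := d_s p (thermo (V x)) in
  let p_s_rho := d_rho (d_s p) (thermo (V x)) in
  e * c ^- 2 * (p_s / rho_bar) * V x 0 (idx_S i)
    * (\sum_a \sum_b wedge_form (D a) (D b) (idx_v b) (idx_v a) V x)
  + e * c ^- 2 * (p_s / rho_bar)
    * (\sum_a \sum_b V x 0 (idx_S b)
         * wedge_form (D a) (D b) (idx_v a) (idx_v i) V x)
  + 2 * e * c ^- 2 * (p_s / rho_bar) * wedge_form Sd B idx_rho (idx_v i) V x
  + 2 * e * c ^- 3 * c_rho * (p_s / rho_bar)
    * wedge_form Sd B idx_rho (idx_v i) V x
  + e * c ^- 2 * (p_s_rho / rho_bar) * wedge_form B Sd idx_rho (idx_v i) V x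
  + e * c ^- 2 * (p_s_rho / rho_bar) * V x 0 (idx_S i)
    * (\sum_a wedge_form B (D a) (idx_v a) idx_rho V x)
  + 2 * e * c ^- 2 * (p_s / rho_bar) * V x 0 (idx_S i)
    * (\sum_a wedge_form (D a) B (idx_v a) idx_rho V x)
  + 2 * e * c ^- 3 * c_rho * (p_s / rho_bar) * V x 0 (idx_S i)
    * (\sum_a wedge_form (D a) B (idx_v a) idx_rho V x))).
  move=> V x /=; rewrite /wedge_form /space_deriv /S_deriv.
  congr (_ + _ + _ + _ + _ + _ + _ + _); congr (_ * _); try by ring.
  - rewrite sum_transpose.
    by apply: eq_bigr => a _; apply: eq_bigr => b _; ring.
  - by apply: eq_bigr => a _; ring.
  - by apply: eq_bigr => a _; ring.
  - by apply: eq_bigr => a _; ring.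
by cbv zeta beta; dec.
Qed.

Lemma decomposable_rhs7 i : dcp (fun V x => rhs (eq7 rho_bar p V i) x).
Proof.
cbv zeta beta iota delta [eq7 rhs].
apply: decomposableD; last exact: decomposable_L_C.
apply: decomposableD; last exact: decomposable_Q_C.
apply: decomposableD; last first.
  apply: decomposableMl; first by coef.
  apply: (@eq_decomposable _ _ _ _ (fun V x => \sum_a
      wedge_form B (D a) (idx_v a) (idx_S i) V x)) => [V x|]; last by dec.
  by apply: eq_bigr => a _; rewrite /wedge_form /space_deriv; ring.
apply: decomposableD; last first.
  apply: decomposableMl; first by coef.
  apply: decomposable_sum => a.
  exact: (decomposable_wedge _ _ (idx_S a) (idx_v i) vector_field_B
            (vector_field_partial _)).
apply: decomposableD.
  apply: decomposableMl; first by coef.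
  (* sum over j of e^{-rho} (grad v^j x grad Omega^j)^i *)
  apply: (@eq_decomposable _ _ _ _ (fun V x => \sum_j \sum_k
      kron j k * expR (- 1 * V x 0 idx_rho) * \sum_a \sum_b eps i a b *
      (partial (Defs.space a) (fun y => V y 0 (idx_v j)) x
       * partial (Defs.space b) (fun y => V y 0 (idx_Omega k)) x))) => [V x|].
    apply: eq_bigr => j _; apply: eq_bigr => k _.
    rewrite mulr_sumr; apply: eq_bigr => a _.
    rewrite mulr_sumr; apply: eq_bigr => b _.
    by rewrite !mulrA [kron _ _ * _ * eps _ _ _]mulrAC.
  apply: decomposable_sum => j; apply: decomposable_sum => k.
  apply: decomposableMl; first by coef.
  exact: decomposable_cross_gradient.
(* sum over k of e^{-rho} (grad v^i x grad Omega^k)^k *)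
apply: (@eq_decomposable _ _ _ _ (fun V x => \sum_k
    expR (- 1 * V x 0 idx_rho) * \sum_a \sum_j eps k a j *
    (partial (Defs.space a) (fun y => V y 0 (idx_v i)) x
     * partial (Defs.space j) (fun y => V y 0 (idx_Omega k)) x))) => [V x|].
  under eq_bigr do rewrite exchange_big.
  rewrite exchange_big; apply: eq_bigr => k _.
  rewrite mulr_sumr; apply: eq_bigr => a _.
  rewrite mulr_sumr; apply: eq_bigr => j _.
  by rewrite eps_cyclic !mulrA [expR _ * eps _ _ _]mulrC.
apply: decomposable_sum => k; apply: decomposableMl; first by coef.
exact: decomposable_cross_gradient.
Qed.

Lemma decomposable_rhs8 : dcp (fun V x => rhs (eq8 V) x).
Proof.
cbv zeta beta iota delta [eq8 rhs].
apply: decomposableD; last exact: decomposable_Q_D.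
apply: decomposableD; last by cbv zeta beta delta [curl]; dec.
apply: decomposableMl; first by coef.
apply: (@eq_decomposable _ _ _ _ (fun V x => \sum_a \sum_b
  wedge_form (D a) (D b) (idx_v a) (idx_S b) V x)).
  move=> V x; rewrite sum_transpose; apply: eq_bigr => a _.
  by apply: eq_bigr => b _; rewrite /wedge_form /space_deriv; ring.
by cbv zeta beta; dec.
Qed.

Lemma decomposable_rhs l : dcp (fun V x => rhs (euler_system rho_bar p V l) x).
Proof.
case: l => [i||i||i||i||i] /=.
- apply: decomposableD; last exact: decomposable_L_v.
  apply: decomposableD; last exact: decomposable_Q_v.
  by apply: decomposableMl; [coef|exact: decomposable_mod_C].
- apply: decomposableD; last exact: decomposable_L_rho.
  apply: decomposableD; last exact: decomposable_Q_rho.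
  by apply: decomposableMl; [coef|exact: decomposable_mod_D].
- exact: decomposable_L_Omega.
- exact: decomposable0.
- exact: decomposable_L_S.
- exact: decomposable_L_div_Omega.
- exact: decomposable_rhs7.
- exact: decomposable_rhs8.
- exact: decomposable0.
Qed.

End RightHandSides.

Unset Implicit Arguments.

Theorem theorem3p2 (R : realType) (rho_bar : R) (p : 'rV[R]_2 -> R)
  (rho_bar_gt0 : 0 < rho_bar)
  (p_smooth : smooth p)
  (c_gt0 : forall z : 'rV[R]_2, 0 < sound_speed rho_bar p z)
  (l : label) :
  exists (n : nat) (T : 'I_n -> @term R),
    (forall j : 'I_n,
       type_i (T j) \/ type_ii (T j) \/ type_iii rho_bar p (T j)) /\
    (forall (V : unknowns R) (x : spacetime R),
       differentiable V x ->
       rhs (euler_system rho_bar p V l) x = \sum_(j < n) T j V x).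
Proof.
have [n [T [aT TE]]] := decomposable_rhs p_smooth c_gt0 l.
by exists n, T; split=> // V x _; exact: TE.
Qed.
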